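(* Let $A$ be a finite Abelian group of order $p_1^{\alpha_1}p_2^{\alpha_2}\cdots p_n^{\alpha_n}$ (prime factorization with distinct primes $p_i$). Let $\phi(A)$ denote the minimal number $k$ for which there exist subgroups $H_1,H_2,\dots,H_k$ of $A$ and elements $x_1,x_2,\dots,x_k\in A$ such that $A\setminus\{1\}=\bigcup_{i=1}^k H_ix_i$. Then $\phi(A)=\sum_{i=1}^n \alpha_i(p_i-1)$.
   Context: Groups are written multiplicatively with identity element $1$. *)

(* Defs.v *)
From HB Require Import structures.
From mathcomp Require Import all_boot all_fingroup.

Set Implicit Arguments.
Unset Strict Implicit.
Unset Printing Implicit Defensive.

Local Open Scope group_scope.

(* k = 0 is allowed: it covers the trivial group, for which A^# is empty.
   The cosets may overlap or repeat. *)
Definition coset_coverable (gT : finGroupType) (A : {group gT}) (k : nat)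
    : bool :=
  [exists H : {ffun 'I_k -> {group gT}}, exists x : {ffun 'I_k -> gT},
    [&& [forall i, H i \subset A], [forall i, x i \in A]
      & A^# == \bigcup_(i < k) (H i :* x i)]].

Lemma coset_coverable_ex (gT : finGroupType) (A : {group gT}) :
  exists k, coset_coverable A k.
Proof.
exists #|A^#|; apply/existsP; exists [ffun=> 1%G].
apply/existsP; exists [ffun i => enum_val i]; apply/and3P; split.
- by apply/forallP => i; rewrite ffunE sub1G.
- by apply/forallP => i; rewrite ffunE; have /setD1P[] := enum_valP i.
apply/eqP/setP => y; apply/idP/bigcupP => [Ay | [i _]].
  by exists (enum_rank_in Ay y); rewrite // !ffunE enum_rankK_in // rcoset_refl.
by rewrite !ffunE mul1g => /set1P ->; apply: enum_valP.
Qed.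

Definition phi (gT : finGroupType) (A : {group gT}) : nat :=
  ex_minn (coset_coverable_ex A).

(* Main.v *)
(* Lower bound: a coset H x that misses 1 lies in a level set {chi = c} of a
   linear character chi of A, where c is a primitive root of unity of prime
   order q.  If such sets with data (chi_i, c_i, q_i) cover A \ {1}, the function
   prod_i (chi_i - c_i) is supported at 1; summing it over A after expanding it
   into linear characters, each of which sums to 0 or #|A|, shows that #|A|
   divides prod_i (1 - c_i) among the algebraic integers.  As (1 - c_i)^(q_i - 1)
   divides q_i, the exponent of p in #|A| is at most #{i | q_i = p} / (p - 1).
   Upper bound: if B has prime index p in A, then A \ {1} is B \ {1} together
   with p - 1 cosets of B. *)
Require Import Defs.
From HB Require Import structures.
From mathcomp Require Import all_boot all_fingroup.
From mathcomp Require Import all_order all_algebra all_solvable all_field.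
From mathcomp Require Import all_character.

Set Implicit Arguments.
Unset Strict Implicit.
Unset Printing Implicit Defensive.

Import GRing.Theory Num.Theory.

Lemma logn_prod (p : nat) (I : Type) (r : seq I) (F : I -> nat) :
  (forall i, 0 < F i) -> logn p (\prod_(i <- r) F i) = \sum_(i <- r) logn p (F i).
Proof.
move=> F_gt0; elim: r => [|i r IHr]; first by rewrite !big_nil logn1.
by rewrite !big_cons lognM ?prodn_gt0 // IHr.
Qed.

(** * Divisibility in the ring of algebraic integers *)

Section CyclotomicDivisibility.
Local Open Scope ring_scope.

Definition Aint_dvd (x y : algC) := exists2 z, z \in Aint & y = z * x.

Lemma Aint_dvd_trans y x z : Aint_dvd x y -> Aint_dvd y z -> Aint_dvd x z.
Proof.
by move=> [u Au ->] [v Av ->]; exists (v * u); rewrite ?rpredM // mulrA.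
Qed.

Lemma Aint_dvdX x y n : Aint_dvd x y -> Aint_dvd (x ^+ n) (y ^+ n).
Proof. by case=> u Au ->; exists (u ^+ n); rewrite ?rpredX // exprMn. Qed.

Lemma Aint_dvd_prod (I : Type) (r : seq I) (x y : I -> algC) :
  (forall i, Aint_dvd (x i) (y i)) ->
  Aint_dvd (\prod_(i <- r) x i) (\prod_(i <- r) y i).
Proof.
move=> xy; apply: (big_ind2 Aint_dvd) => [|x1 y1 x2 y2 [u Au ->] [v Av ->]|//].
  by exists 1; rewrite ?rpred1 ?mulr1.
by exists (u * v); rewrite ?rpredM // mulrACA.
Qed.

(** The cofactor is the rational number n / m, and a rational algebraic integer is an integer. *)
Lemma Aint_dvd_nat m n : (0 < m)%N -> Aint_dvd m%:R n%:R -> (m %| n)%N.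
Proof.
move=> m_gt0 [z Az Dn].
have nz_m: m%:R != 0 :> algC by rewrite pnatr_eq0 -lt0n.
have Dz: z = n%:R / m%:R by rewrite Dn mulfK.
have /intrP[k Dk]: z \is a Num.int.
  by apply: Cint_rat_Aint => //; rewrite Dz rpred_div ?rpred_nat.
have /eqP: n%:Z = k * m%:Z.
  by apply: (@intr_inj algC); rewrite rmorphM /= -Dk.
rewrite -(absz_nat n) => /eqP->.
by rewrite abszM dvdn_mull.
Qed.

(* (1 - c)^(q - 1) divides prod_(0 < j < q) (1 - c^j) = q *)
Lemma sub1_prim_root_dvd q (c : algC) :
  q.-primitive_root c -> Aint_dvd ((1 - c) ^+ (q - 1)) q%:R.
Proof.
move=> prim_c; have q_gt0 := prim_order_gt0 prim_c.
have Dq: q%:R = \prod_(1 <= j < q) (1 - c ^+ j).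
  (* Cancel X - 1 between the two factorizations of X^q - 1, then evaluate at 1. *)
  have: 'X - 1 != 0 :> {poly algC} by rewrite polyXsubC_eq0.
  move/mulfI/(_ (\prod_(1 <= j < q) ('X - (c ^+ j)%:P)) (\sum_(i < q) 'X^i)).
  rewrite -subrX1 -(factor_Xn_sub_1 prim_c) [RHS]big_ltn // expr0.
  move/(_ erefl)/(congr1 (horner^~ 1)).
  rewrite horner_prod horner_sum => Dprod.
  under eq_bigr do rewrite -[1](hornerX 1) -[c ^+ _](hornerC _ 1) -hornerN -hornerD.
  rewrite Dprod (eq_bigr (fun=> 1)) => [|i _]; last by rewrite hornerXn expr1n.
  by rewrite sumr_const card_ord.
rewrite Dq -prodr_const_nat.
apply: Aint_dvd_prod => j; exists (\sum_(i < j) c ^+ i).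
  by rewrite rpred_sum // => i _; rewrite rpredX // (Aint_prim_root prim_c).
by rewrite mulrC -(opprB c) mulNr -subrX1 opprB.
Qed.
End CyclotomicDivisibility.

(** * Lower bound through linear characters *)

Section LowerBound.
Local Open Scope ring_scope.
Variables (gT : finGroupType) (A : {group gT}).

Lemma card_dvd_sum_lin_char (xi : 'CF(A)) : xi \is a linear_char ->
  Aint_dvd #|A|%:R (\sum_(a in A) xi a).
Proof.
move=> lin_xi; have /irrP[i Dxi] := lin_char_irr lin_xi.
exists (i == 0)%:R; first by rewrite rpred_nat.
rewrite -(first_orthogonality_relation i 0) mulrAC mulVf ?mul1r ?neq0CG //.
by apply: eq_bigr => a Aa; rewrite Dxi irr0 cfun1E groupV Aa mulr1.
Qed.

(** The free factor [xi] carries the induction: expanding one factor [chi i - c i] leaves a sum with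
    [xi * chi i] in place of [xi], minus [c i] times the sum for [xi]. *)
Lemma card_dvd_sum_prod (I : Type) (r : seq I) (chi : I -> 'CF(A))
    (c : I -> algC) (xi : 'CF(A)) :
    (forall i, chi i \is a linear_char) -> (forall i, c i \in Aint) ->
    xi \is a linear_char ->
  Aint_dvd #|A|%:R (\sum_(a in A) xi a * \prod_(i <- r) (chi i a - c i)).
Proof.
move=> lin_chi Ac; elim: r xi => [|i r IHr] xi lin_xi.
  under eq_bigr do rewrite big_nil mulr1.
  exact: card_dvd_sum_lin_char.
have [u Au Du] := IHr _ lin_xi.
have [v Av Dv] := IHr _ (rpredM lin_xi (lin_chi i)).
exists (v - c i * u); first by rewrite rpredB ?rpredM.
rewrite mulrBl -mulrA -Dv -Du mulr_sumr -sumrB.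
by apply: eq_bigr => a _; rewrite big_cons cfunE mulrBl mulrBr mulrA mulrCA.
Qed.

(** A linear character of A / H lifts to one of A that is constant on H x; it is chosen nontrivial
    at x, and a suitable power of it takes there a value of prime order. *)
Lemma coset_lin_char (H : {group gT}) (x : gT) :
    abelian A -> H \subset A -> x \in A -> x \notin H ->
  exists t : 'CF(A) * algC * nat,
    [/\ t.1.1 \is a linear_char, prime t.2, t.2.-primitive_root t.1.2
      & {in (H :* x)%g, forall a, t.1.1 a = t.1.2}].
Proof.
move=> abelA sHA Ax notHx.
have nsHA: (H <| A)%g by rewrite -sub_abelian_normal.
have abelAH := quotient_abelian H abelA.
have ntx: coset H x != 1%g.
  by apply: contra notHx => /eqP/coset_idr-> //; apply: (subsetP (normal_norm nsHA)).
(* The kernels of the irreducible characters of A / H intersect trivially. *)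
have [i xi_x]: exists i : Iirr (A / H)%g, 'chi_i (coset H x) != 1.
  apply/existsP; apply: contraR ntx; rewrite negb_exists => /forallP chi1.
  rewrite -in_set1 -[[set _]](TI_cfker_irr (A / H)%G); apply/bigcapP=> i _.
  rewrite cfkerEirr inE (lin_char1 (char_abelianP _ abelAH i)).
  by have := chi1 i; rewrite negbK.
set xi := ('chi_i %% H)%CF.
have lin_xi: xi \is a linear_char.
  exact/cfMod_lin_char/(char_abelianP _ abelAH).
have [m prim_m _] :=
  prim_order_exists (order_gt0 x) (lin_char_unity_root lin_xi Ax).
have m_gt1: (1 < m)%N.
  case: m prim_m (prim_order_gt0 prim_m) => [|[|//]] // /prim_expr_order.
  by rewrite expr1 cfModE // => xi1; rewrite xi1 eqxx in xi_x.
have q_prime := pdiv_prime m_gt1; set q := pdiv m in q_prime.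
(* [xi x] has order m, so its power of exponent m / q has order q. *)
exists (xi ^+ (m %/ q), xi x ^+ (m %/ q), q); split=> //=.
- exact: rpredX.
- exact: (dvdn_prim_root prim_m (pdiv_dvd m)).
move=> _ /rcosetP[h Hh ->]; have Ah := subsetP sHA h Hh.
have E n y : y \in A -> (xi ^+ n) y = xi y ^+ n.
  move=> Ay; elim: n => [|n IHn]; first by rewrite !expr0 cfun1E Ay.
  by rewrite !exprS cfunE IHn.
rewrite E ?groupM // lin_charM // -[in RHS](mul1r (xi x)); congr ((_ * _) ^+ _).
rewrite cfModE // (coset_id Hh) lin_char1 //.
exact: (char_abelianP _ abelAH).
Qed.

(** Each coset receives a single prime [q i], independent of p, so the inequalities for distinct p
    count disjoint sets of cosets and can be added. *)
Lemma coset_coverable_logn k : abelian A -> coset_coverable A k ->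
  exists q : 'I_k -> nat,
    forall p, prime p -> (logn p #|A| * (p - 1) <= #|[pred i | q i == p]|)%N.
Proof.
move=> abelA /existsP[H /existsP[x /and3P[/forallP sHA /forallP Ax]]].
move=> /eqP covA.
have notHx i : x i \notin H i.
  apply/negP=> Hx; have: 1%g \in (A^#)%g.
    by rewrite covA; apply/bigcupP; exists i; rewrite // mem_rcoset mul1g groupV.
  by rewrite !inE eqxx.
have [t Pt] := fin_all_exists (fun i => coset_lin_char abelA (sHA i) (Ax i) (notHx i)).
pose chi i := (t i).1.1; pose c i := (t i).1.2; pose q i := (t i).2.
have lin_chi i : chi i \is a linear_char by case: (Pt i).
have q_prime i : prime (q i) by case: (Pt i).
have prim_c i : (q i).-primitive_root (c i) by case: (Pt i).
have chi_c i : {in (H i :* x i)%g, forall a, chi i a = c i} by case: (Pt i).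
have q1_gt0 i : (0 < q i - 1)%N by rewrite subn_gt0 prime_gt1.
have dvA: Aint_dvd #|A|%:R (\prod_i (1 - c i)).
  have:= card_dvd_sum_prod (index_enum 'I_k) lin_chi
           (fun i => Aint_prim_root (prim_c i)) (cfun1_lin_char A).
  rewrite (big_setD1 1%g) //= [X in _ + X]big1 => [|a].
    rewrite addr0 cfun1E group1 mul1r.
    by under eq_bigr do rewrite lin_char1 //.
  rewrite covA => /bigcupP[i _ Ha].
  by rewrite (bigD1 i) //= chi_c // subrr mul0r mulr0.
(* All the exponents M / (q i - 1) below are integers. *)
pose M := (\prod_i (q i - 1))%N.
have M_gt0: (0 < M)%N by rewrite prodn_gt0.
have dvM i : (q i - 1 %| M)%N by rewrite /M (bigD1 i) ?dvdn_mulr.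
(* Raise [dvA] to the power M: then (1 - c_i)^M divides q_i^(M / (q_i - 1)), and the resulting
   divisibility is between natural numbers. *)
have dvN: (#|A| ^ M %| \prod_i q i ^ (M %/ (q i - 1)))%N.
  apply: Aint_dvd_nat; first by rewrite expn_gt0 cardG_gt0.
  rewrite natrX natr_prod; apply: Aint_dvd_trans (Aint_dvdX M dvA) _.
  rewrite -prodrXl; apply: Aint_dvd_prod => i.
  rewrite -{1}(divnK (dvM i)) mulnC exprM natrX.
  exact/Aint_dvdX/sub1_prim_root_dvd.
exists q => p p_prime.
have:= dvdn_leq_log p _ dvN; rewrite prodn_gt0 => [|i]; last first.
  by rewrite expn_gt0 prime_gt0.
move/(_ isT); rewrite lognX logn_prod => [|i]; last by rewrite expn_gt0 prime_gt0.
have -> : (\sum_i logn p (q i ^ (M %/ (q i - 1))) =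
           #|[pred i | q i == p]| * (M %/ (p - 1)))%N.
  rewrite -sum_nat_const [RHS]big_mkcond /=; apply: eq_bigr => i _.
  rewrite lognX logn_prime // inE eq_sym.
  by case: eqP => [->|_]; rewrite ?muln1 ?muln0.
(* When p is none of the [q i], p - 1 may fail to divide M; rounding down still gives
   [M %/ (p - 1) * (p - 1) <= M]. *)
move=> le_log; rewrite -(leq_pmul2l M_gt0) mulnA.
apply: leq_trans (leq_mul le_log (leqnn _)) _.
by rewrite -mulnA mulnC leq_mul2r leq_trunc_div orbT.
Qed.
End LowerBound.

(** * Upper bound by descending through subgroups of prime index *)

Section UpperBound.
Local Open Scope group_scope.

(** A minus B is the union of the cosets of B other than B itself (the set [R]); they are appended
    to the k cosets covering B minus 1. *)
Lemma coset_coverableS (gT : finGroupType) (A B : {group gT}) k :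
  B \subset A -> coset_coverable B k -> coset_coverable A (k + (#|A : B| - 1)).
Proof.
move=> sBA /existsP[H /existsP[x /and3P[/forallP sHB /forallP Bx /eqP covB]]].
pose R := rcosets B A :\ (B : {set gT}).
have cardR: #|R| = #|A : B| - 1.
  have RB: (B : {set gT}) \in rcosets B A.
    by rewrite -{1}(mulg1 B) mem_rcosets mulSGid.
  by rewrite [#|A : B|](cardsD1 (B : {set gT})) RB add1n subn1.
have R_A (i : 'I_(#|A : B| - 1)) : exists2 y, y \in A &
  enum_val (cast_ord (esym cardR) i) = B :* y.
  have /setD1P[_ /rcosetsP[y Ay ->]] := enum_valP (cast_ord (esym cardR) i).
  by exists y.
have [y Ay Dy] := fin_all_exists2 R_A.
apply/existsP; exists [ffun i => if split i is inl j then H j else B].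
apply/existsP; exists [ffun i => match split i with inl j => x j | inr j => y j end].
apply/and3P; split.
- apply/forallP => i; rewrite ffunE; case: split => [j|_ //].
  exact: subset_trans (sHB j) sBA.
- by apply/forallP => i; rewrite ffunE; case: split => // j; apply: (subsetP sBA).
apply/eqP; rewrite big_split_ord /=.
rewrite (eq_bigr (fun j => H j :* x j)) => [|j _]; last first.
  by rewrite !ffunE; case: split_ordP => j' /eqP; rewrite ?eq_lshift ?eq_lrshift // => /eqP->.
rewrite [X in _ :|: X](eq_bigr (fun j => B :* y j)) => [|j _]; last first.
  by rewrite !ffunE; case: split_ordP => j' /eqP; rewrite ?eq_rshift ?eq_rlshift // => /eqP->.
rewrite -covB; apply/setP => a; rewrite !inE.
have -> : (a \in \bigcup_i B :* y i) = (a \in A) && (a \notin B).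
  apply/bigcupP/andP=> [[i _ Ba] | [Aa notBa]].
    have /setD1P[ntB _] := enum_valP (cast_ord (esym cardR) i).
    rewrite Dy in ntB; case/rcosetP: Ba ntB => b Bb ->.
    rewrite groupM ?(subsetP sBA b) // groupMl //; split=> //.
    by apply: contra ntB => /rcoset_id->.
  have Ra: B :* a \in R.
    rewrite !inE mem_rcosets mulSGid // Aa andbT.
    by apply: contra notBa => /eqP<-; apply: rcoset_refl.
  exists (cast_ord cardR (enum_rank_in Ra (B :* a))) => //.
  by rewrite -Dy cast_ordK enum_rankK_in ?rcoset_refl.
have [Ba | notBa] := boolP (a \in B); first by rewrite (subsetP sBA) // andbF orbF.
by rewrite !andbF andbT /= andb_idl // => _; apply: contra notBa => /eqP->.
Qed.

Lemma coset_coverable_abelian (gT : finGroupType) (A : {group gT}) (n : nat)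
    (p alpha : 'I_n -> nat) :
    abelian A -> (forall i, prime (p i)) ->
    #|A| = (\prod_(i < n) p i ^ alpha i)%N ->
  coset_coverable A (\sum_(i < n) alpha i * (p i - 1))%N.
Proof.
(* The exponents are generalized along with A, since passing to a subgroup of index [p i] lowers
   [alpha i] by one. *)
have [m] := ubnP #|A|; elim: m => // m IHm in A alpha * => ltAm abelA p_prime cardA.
have [A1 | ntA] := eqVneq (A :> {set gT}) 1.
  (* For trivial A all exponents vanish and the empty cover works. *)
  rewrite big1 => [|i _].
    apply/existsP; exists [ffun=> 1%G]; apply/existsP; exists [ffun=> 1].
    apply/and3P; split; try by apply/forallP=> -[].
    by rewrite big_ord0 A1 setDv.
  apply/eqP; rewrite muln_eq0; apply/orP; left.
  have: (p i ^ alpha i == 1)%N.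
    by rewrite -dvdn1 -(cards1 (1 : gT)) -[[set 1]]A1 cardA (bigD1 i) //= dvdn_mulr.
  case: (alpha i) => // a; rewrite expnS muln_eq1 => /andP[/eqP p1 _].
  by have:= p_prime i; rewrite p1.
have [B nsBA idx_prime] := sol_prime_factor_exists (abelian_sol abelA) ntA.
have sBA := normal_sub nsBA.
have [i alpha_gt0 Dp]: exists2 i, 0 < alpha i & #|A : B| = p i.
  have: #|A : B| %| (\prod_(i < n) p i ^ alpha i)%N by rewrite -cardA dvdn_indexg.
  rewrite Euclid_dvd_prod // big_has => /hasP[i _].
  rewrite Euclid_dvdX // => /andP[dvp alpha_gt0]; exists i => //.
  by apply/eqP; rewrite -dvdn_prime2.
pose beta j := alpha j - (j == i).
have cardB: #|B| = (\prod_(j < n) p j ^ beta j)%N.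
  apply/eqP; rewrite -(eqn_pmul2r (prime_gt0 (p_prime i))) -{1}Dp Lagrange //.
  rewrite cardA (bigD1 i) //= [X in _ == (X * _)%N](bigD1 i) //= /beta eqxx subn1.
  rewrite mulnC -mulnA [(_ * p i)%N]mulnC mulnA -expnSr prednK // mulnC.
  rewrite eqn_pmul2l ?expn_gt0 ?prime_gt0 //; apply/eqP/eq_bigr=> j /negPf->.
  by rewrite subn0.
have ltBm: #|B| < m.
  apply: leq_trans (_ : #|A| <= m) => //.
  by rewrite -(Lagrange sBA) ltn_Pmulr ?prime_gt1.
have := coset_coverableS sBA (IHm B beta ltBm (abelianS sBA abelA) p_prime cardB).
rewrite Dp (bigD1 i) //= [in X in _ -> X](bigD1 i) //= /beta eqxx [(alpha i - true)%N]subn1.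
rewrite addnAC -mulSnr prednK //; congr (coset_coverable A (_ + _)).
by apply: eq_bigr => j /negPf->; rewrite subn0.
Qed.
End UpperBound.

Lemma logn_prod_distinct_primes n (p alpha : 'I_n -> nat) j :
  (forall i, prime (p i)) -> injective p ->
  logn (p j) (\prod_(i < n) p i ^ alpha i) = alpha j.
Proof.
move=> p_prime p_inj; rewrite logn_prod => [|i]; last first.
  by rewrite expn_gt0 prime_gt0.
rewrite (bigD1 j) //= big1 => [|i ne_ij]; rewrite lognX logn_prime //.
  by rewrite eqxx muln1 addn0.
by rewrite inj_eq // eq_sym (negPf ne_ij) muln0.
Qed.

Theorem theorem5 (gT : finGroupType) (A : {group gT}) (n : nat)
    (p alpha : 'I_n -> nat)
    (abelA : abelian A)
    (p_prime : forall i, prime (p i))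
    (p_inj : injective p)
    (cardA : #|A| = (\prod_(i < n) p i ^ alpha i)%N) :
  phi A = (\sum_(i < n) alpha i * (p i - 1))%N.
Proof.
rewrite /phi; case: ex_minnP => k covA mink; apply/eqP.
rewrite eqn_leq mink ?coset_coverable_abelian //=.
have [q le_logn] := coset_coverable_logn abelA covA.
apply: (@leq_trans (\sum_(i < n) #|[pred j | q j == p i]|)).
  apply: leq_sum => i _.
  by rewrite -[alpha i](logn_prod_distinct_primes alpha i p_prime p_inj) -cardA le_logn.
(* Double counting: as [p] is injective, each coset index j has [q j = p i] for at most one i. *)
rewrite -[leqRHS]card_ord -sum1_card.
under [leqLHS]eq_bigr do rewrite -sum1_card big_mkcond.
rewrite exchange_big leq_sum //= => j _.
rewrite -big_mkcond sum1_card /=; apply/card_le1_eqP => i1 i2.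
by rewrite ![_ \in _]unfold_in /= => /eqP-> /eqP/p_inj.
Qed.
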